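(* Let $\mathbf E$ be one of the envelope operations $\mathbf E\in\{\mathbf S,\mathbf A,\mathbf{Tw},\mathbf{Twix},\mathbf{Pretr}\}$. Then for any dg category $\mathcal C$ there is an isomorphism of dg categories $\mathbf E(\mathcal C)^{\mathrm{op}}\cong\mathbf E(\mathcal C^{\mathrm{op}})$.
   Context: **Ground conventions.** Fix a commutative ring $K$, an abelian group $\Gamma$, a symmetric bilinear form $\langle\ ,\ \rangle\colon\Gamma\times\Gamma\to\mathbb Z/2$ and $\iota\in\Gamma$ with $\langle\iota,\iota\rangle=1$. A dg module is a $\Gamma$-graded $K$-module with a differential of degree $\iota$ squaring to zero; only homogeneous elements are considered and $|f|$ denotes degree. A dg category is a category enriched in dg modules over $K$, so $d(f\circ g)=d(f)\circ g+(-1)^{\langle\iota,|f|\rangle}f\circ d(g)$. **Opposite.** $\mathcal C^{\mathrm{op}}$ has objects $X^{\mathrm{op}}$ for $X\in\mathcal C$ and $\mathrm{Hom}_{\mathcal C^{\mathrm{op}}}(Y^{\mathrm{op}},X^{\mathrm{op}})=\{f^{\mathrm{op}}\mid f\in\mathrm{Hom}_{\mathcal C}(X,Y)\}$ with $|f^{\mathrm{op}}|=|f|$, $d(f^{\mathrm{op}})=d(f)^{\mathrm{op}}$, $f^{\mathrm{op}}\circ g^{\mathrm{op}}=(-1)^{\langle|f|,|g|\rangle}(g\circ f)^{\mathrm{op}}$. **Envelopes.** $\mathbf S(\mathcal C)$: objects $q^iX$ ($i\in\Gamma$, $X\in\mathcal C$), $\mathrm{Hom}^l(q^iX,q^jY)=\mathrm{Hom}^{l+i-j}_{\mathcal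 C}(X,Y)$; the element corresponding to $f$ is written $f^j_i$, with $d(f^j_i)=(-1)^{\langle\iota,j\rangle}d(f)^j_i$ and $g^k_j\circ f^j_i=(g\circ f)^k_i$. $\mathbf A(\mathcal C)$: objects formal expressions $\bigoplus_{a\in A}X_a$ with $A$ a finite set and $X_a\in\mathcal C$; morphisms $\bigoplus_{b\in B}Y_b\to\bigoplus_{a\in A}X_a$ are $A\times B$ matrices $(f_{a,b})$, $f_{a,b}\in\mathrm{Hom}_{\mathcal C}(Y_b,X_a)$, composed by matrix multiplication, with componentwise differential. $\mathbf{Tw}(\mathcal C)$: objects $\mathrm{tw}_\alpha(X)$ with $\alpha\in\mathrm{End}^\iota_{\mathcal C}(X)$, $d(\alpha)+\alpha^2=0$; $\mathrm{Hom}(\mathrm{tw}_\alpha(X),\mathrm{tw}_\beta(Y))=\mathrm{Hom}_{\mathcal C}(X,Y)$ as graded modules, same composition, with differential $f\mapsto d_{\mathcal C}(f)+\beta\circ f-(-1)^{\langle\iota,|f|\rangle}f\circ\alpha$. $\mathbf{Twix}(\mathcal C):=\mathbf{Tw}(\mathbf A(\mathbf S(\mathcal C)))$, with objects the finite twisted complexes $\mathrm{tw}_\alpha(\bigoplus_{a\in A}q^{i_a}X_a)$. $\mathbf{Pretr}(\mathcal C)\subset\mathbf{Twix}(\mathcal C)$: the full subcategory on the one-sided twisted complexes, i.e. those for which $A$ admits a partial order with $\alpha_{a,b}=0$ unless $a>b$. *)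

(* Defs.v *)
From HB Require Import structures.
From mathcomp Require Import all_boot all_order all_algebra.

Set Implicit Arguments.
Unset Strict Implicit.
Unset Printing Implicit Defensive.

Import GRing.Theory.
Local Open Scope ring_scope.

Record dgGround := DgGround {
  gK : comPzRingType;
  gG : zmodType;
  gform : gG -> gG -> 'Z_2;
  gform_sym : forall x y, gform x y = gform y x;
  gform_addl : forall x y z, gform (x + y) z = gform x z + gform y z;
  giota : gG;
  giota_odd : gform giota giota = 1
}.
Arguments gform {d} _ _.
Arguments giota {d}.

Definition sgn (R : comPzRingType) (e : 'Z_2) : R := (-1) ^+ e.

Notation ksgn G x y := (sgn (gK G) (gform x y)).

(* Homs are families of K-modules indexed by the degree.  Composition and
   differential take a proof relating the degrees, which avoids transport along
   the group laws; proofs are irrelevant, degrees lying in an eqType.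
   Compatibility of the identities with the differential is [hdiff_id]. *)
Record dgCat (G : dgGround) := DgCat {
  Obj :> Type;
  Hom : Obj -> Obj -> gG G -> lmodType (gK G);
  hid : forall X, Hom X X 0;
  hcomp : forall X Y Z l m n, l + m = n -> Hom Y Z l -> Hom X Y m -> Hom X Z n;
  hdiff : forall X Y l l', l + giota = l' -> Hom X Y l -> Hom X Y l';
  hcomp_linl : forall X Y Z l m n (e : l + m = n) (f : Hom X Y m),
    linear (fun g : Hom Y Z l => hcomp e g f);
  hcomp_linr : forall X Y Z l m n (e : l + m = n) (g : Hom Y Z l),
    linear (fun f : Hom X Y m => hcomp e g f);
  hdiff_lin : forall X Y l l' (e : l + giota = l'),
    linear (fun f : Hom X Y l => hdiff e f);
  hcompA : forall W X Y Z l m n lm mn k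
    (e1 : l + m = lm) (e2 : lm + n = k) (e3 : m + n = mn) (e4 : l + mn = k)
    (h : Hom Y Z l) (g : Hom X Y m) (f : Hom W X n),
    hcomp e2 (hcomp e1 h g) f = hcomp e4 h (hcomp e3 g f);
  hcomp1l : forall X Y l (e : 0 + l = l) (f : Hom X Y l),
    hcomp e (hid Y) f = f;
  hcomp1r : forall X Y l (e : l + 0 = l) (f : Hom X Y l),
    hcomp e f (hid X) = f;
  hdiffK : forall X Y l l' l'' (e : l + giota = l') (e' : l' + giota = l'')
    (f : Hom X Y l), hdiff e' (hdiff e f) = 0;
  hdiff_comp : forall X Y Z l m n l' m' n' (e : l + m = n) (en : n + giota = n')
    (el : l + giota = l') (e1 : l' + m = n') (em : m + giota = m')
    (e2 : l + m' = n') (g : Hom Y Z l) (f : Hom X Y m),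
    hdiff en (hcomp e g f) =
      hcomp e1 (hdiff el g) f + ksgn G giota l *: hcomp e2 g (hdiff em f)
}.
Arguments Hom {G} d _ _ _.
Arguments hid {G d} X.
Arguments hcomp {G d X Y Z l m n} e g f.
Arguments hdiff {G d X Y l l'} e f.

Record dgFunctor G (C D : dgCat G) := DgFunctor {
  fobj : C -> D;
  fhom : forall X Y l, Hom C X Y l -> Hom D (fobj X) (fobj Y) l;
  fhom_lin : forall X Y l, linear (@fhom X Y l);
  fhom_id : forall X, fhom (hid X) = hid (fobj X);
  fhom_comp : forall X Y Z l m n (e : l + m = n)
    (g : Hom C Y Z l) (f : Hom C X Y m),
    fhom (hcomp e g f) = hcomp e (fhom g) (fhom f);
  fhom_diff : forall X Y l l' (e : l + giota = l') (f : Hom C X Y l),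
    fhom (hdiff e f) = hdiff e (fhom f)
}.
Arguments fobj {G C D} d _.
Arguments fhom {G C D} d {X Y l} _.

Lemma linear_id (R : pzRingType) (V : lmodType R) : linear (fun x : V => x).
Proof. by []. Qed.

Definition dgFunctor_id G (C : dgCat G) : dgFunctor C C :=
  @DgFunctor G C C (fun X => X) (fun _ _ _ f => f)
    (fun X Y l => @linear_id _ (Hom C X Y l))
    (fun=> erefl) (fun _ _ _ _ _ _ _ _ _ => erefl) (fun _ _ _ _ _ _ => erefl).

Section FunctorComposition.
Variables (G : dgGround) (C D E : dgCat G).
Variables (Q : dgFunctor D E) (P : dgFunctor C D).

Definition dgFunctor_comp : dgFunctor C E.
Proof.
refine (@DgFunctor G C E (fun X => fobj Q (fobj P X))
  (fun X Y l f => fhom Q (fhom P f)) _ _ _ _).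
- by move=> X Y l a u v; rewrite !fhom_lin.
- by move=> X; rewrite !fhom_id.
- by move=> X Y Z l m n e g f; rewrite !fhom_comp.
- by move=> X Y l l' e f; rewrite !fhom_diff.
Defined.

End FunctorComposition.

Definition dgIso G (C D : dgCat G) : Prop :=
  exists (P : dgFunctor C D) (Q : dgFunctor D C),
    dgFunctor_comp Q P = dgFunctor_id C /\ dgFunctor_comp P Q = dgFunctor_id D.

Section GroundTheory.
Variable G : dgGround.
Implicit Types (x y z : gG G) (a b : 'Z_2).

Lemma gform_addr x y z : gform x (y + z) = gform x y + gform x z.
Proof. by rewrite gform_sym gform_addl !(gform_sym _ x). Qed.

Lemma gform0l x : gform 0 x = 0.
Proof. by apply: (@addrI _ (gform 0 x)); rewrite -gform_addl !addr0. Qed.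

Lemma gform0r x : gform x 0 = 0.
Proof. by rewrite gform_sym gform0l. Qed.

Lemma addZ2 a : a + a = 0.
Proof. by case: a => [[|[|]]] // i; apply: val_inj. Qed.

Lemma oppZ2 a : - a = a.
Proof. by apply/eqP; rewrite eq_sym -addr_eq0 addZ2. Qed.

Lemma gformNr x y : gform x (- y) = gform x y.
Proof.
rewrite -[RHS]oppZ2; apply/eqP; rewrite -addr_eq0 -gform_addr.
by rewrite addNr gform0r.
Qed.

Lemma sgn0 (R : comPzRingType) : sgn R 0 = 1.
Proof. by []. Qed.

Lemma sgn1 (R : comPzRingType) : sgn R 1 = -1.
Proof. by []. Qed.

Lemma sgnD (R : comPzRingType) a b : sgn R (a + b) = sgn R a * sgn R b.
Proof.
rewrite /sgn -exprD.
by case: a b => [[|[|]]] // i [[|[|]]] // j; rewrite //= expr2 mulrNN mulr1.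
Qed.

Lemma sgnK (R : comPzRingType) a : sgn R a * sgn R a = 1.
Proof. by rewrite -sgnD addZ2. Qed.

Lemma ksgnS x : ksgn G giota (x + giota) = - ksgn G giota x.
Proof. by rewrite gform_addr giota_odd sgnD sgn1 mulrN1. Qed.

End GroundTheory.

Section DgCatTheory.
Variables (G : dgGround) (C : dgCat G).
Implicit Types X Y Z : C.

Lemma hcompDl X Y Z l m n (e : l + m = n) (g g' : Hom C Y Z l)
    (f : Hom C X Y m) :
  hcomp e (g + g') f = hcomp e g f + hcomp e g' f.
Proof. by have := hcomp_linl e f 1 g g'; rewrite !scale1r. Qed.

Lemma hcompDr X Y Z l m n (e : l + m = n) (g : Hom C Y Z l)
    (f f' : Hom C X Y m) :
  hcomp e g (f + f') = hcomp e g f + hcomp e g f'.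
Proof. by have := hcomp_linr e g 1 f f'; rewrite !scale1r. Qed.

Lemma hdiffD X Y l l' (e : l + giota = l') (f f' : Hom C X Y l) :
  hdiff e (f + f') = hdiff e f + hdiff e f'.
Proof. by have := hdiff_lin e 1 f f'; rewrite !scale1r. Qed.

Lemma hcomp0l X Y Z l m n (e : l + m = n) (f : Hom C X Y m) :
  hcomp e (0 : Hom C Y Z l) f = 0.
Proof. by apply: (@addrI _ (hcomp e 0 f)); rewrite -hcompDl !addr0. Qed.

Lemma hcomp0r X Y Z l m n (e : l + m = n) (g : Hom C Y Z l) :
  hcomp e g (0 : Hom C X Y m) = 0.
Proof. by apply: (@addrI _ (hcomp e g 0)); rewrite -hcompDr !addr0. Qed.

Lemma hdiff0 X Y l l' (e : l + giota = l') : hdiff e (0 : Hom C X Y l) = 0.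
Proof. by apply: (@addrI _ (hdiff e 0)); rewrite -hdiffD !addr0. Qed.

Lemma hcompZl X Y Z l m n (e : l + m = n) k (g : Hom C Y Z l)
    (f : Hom C X Y m) :
  hcomp e (k *: g) f = k *: hcomp e g f.
Proof. by have := hcomp_linl e f k g 0; rewrite hcomp0l !addr0. Qed.

Lemma hcompZr X Y Z l m n (e : l + m = n) k (g : Hom C Y Z l)
    (f : Hom C X Y m) :
  hcomp e g (k *: f) = k *: hcomp e g f.
Proof. by have := hcomp_linr e g k f 0; rewrite hcomp0r !addr0. Qed.

Lemma hdiffZ X Y l l' (e : l + giota = l') k (f : Hom C X Y l) :
  hdiff e (k *: f) = k *: hdiff e f.
Proof. by have := hdiff_lin e k f 0; rewrite hdiff0 !addr0. Qed.

Lemma hcompNl X Y Z l m n (e : l + m = n) (g : Hom C Y Z l)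
    (f : Hom C X Y m) :
  hcomp e (- g) f = - hcomp e g f.
Proof. by rewrite -scaleN1r hcompZl scaleN1r. Qed.

Lemma hcompNr X Y Z l m n (e : l + m = n) (g : Hom C Y Z l)
    (f : Hom C X Y m) :
  hcomp e g (- f) = - hcomp e g f.
Proof. by rewrite -scaleN1r hcompZr scaleN1r. Qed.

Lemma hdiffN X Y l l' (e : l + giota = l') (f : Hom C X Y l) :
  hdiff e (- f) = - hdiff e f.
Proof. by rewrite -scaleN1r hdiffZ scaleN1r. Qed.

Lemma hcomp_suml X Y Z l m n (e : l + m = n) (I : finType)
    (g : I -> Hom C Y Z l) (f : Hom C X Y m) :
  hcomp e (\sum_i g i) f = \sum_i hcomp e (g i) f.
Proof.
by apply: (big_morph (fun g => hcomp e g f)) => [u v|];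
  rewrite ?hcompDl ?hcomp0l.
Qed.

Lemma hcomp_sumr X Y Z l m n (e : l + m = n) (I : finType)
    (g : Hom C Y Z l) (f : I -> Hom C X Y m) :
  hcomp e g (\sum_i f i) = \sum_i hcomp e g (f i).
Proof.
by apply: (big_morph (fun f => hcomp e g f)) => [u v|];
  rewrite ?hcompDr ?hcomp0r.
Qed.

Lemma hdiff_sum X Y l l' (e : l + giota = l') (I : finType)
    (f : I -> Hom C X Y l) :
  hdiff e (\sum_i f i) = \sum_i hdiff e (f i).
Proof.
by apply: (big_morph (fun f => hdiff e f)) => [u v|]; rewrite ?hdiffD ?hdiff0.
Qed.

Lemma hdiff_id X l (e : 0 + giota = l) : hdiff e (hid X) = 0.
Proof.
case: _ / e.
have := hdiff_comp (addr0 0) erefl erefl (addr0 _) erefl (add0r _)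
          (hid X) (hid X).
rewrite hcomp1l gform0r sgn0 scale1r.
have -> (f : Hom C X X (0 + giota)) : hcomp (add0r _) (hid X) f = f.
  exact: hcomp1l.
by rewrite hcomp1r -[LHS]addr0 => /addrI <-.
Qed.

Definition hcast X Y l l' (e : l = l') (f : Hom C X Y l) : Hom C X Y l' :=
  ecast k (Hom C X Y k) e f.

End DgCatTheory.


Section Opposite.
Variables (G : dgGround) (C : dgCat G).

(* X^op and f^op are represented by X and f. *)
Definition op_hom (X Y : C) l := Hom C Y X l.

Definition op_comp X Y Z l m n (e : l + m = n) (g : op_hom Y Z l)
    (f : op_hom X Y m) : op_hom X Z n :=
  ksgn G l m *: hcomp (etrans (addrC m l) e) f g.

Program Definition dgOp : dgCat G :=
  @DgCat G C op_hom (fun X => hid X) op_comp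
    (fun X Y l l' e (f : op_hom X Y l) => hdiff e f) _ _ _ _ _ _ _ _.
Next Obligation.
by rewrite /op_comp => X Y Z l m n e f a u v; rewrite hcomp_linr scalerDr !scalerA mulrC.
Qed.
Next Obligation.
by rewrite /op_comp => X Y Z l m n e f a u v; rewrite hcomp_linl scalerDr !scalerA mulrC.
Qed.
Next Obligation. by move=> X Y l l' e a u v; rewrite hdiff_lin. Qed.
Next Obligation.
rewrite /op_comp => W X Y Z l m n lm mn k e1 e2 e3 e4 h g f.
rewrite hcompZl hcompZr !scalerA -!sgnD; congr (sgn _ _ *: _); last first.
  exact/esym/hcompA.
by rewrite -e1 -e3 gform_addl gform_addr addrC addrA addrAC.
Qed.
Next Obligation.
by rewrite /op_comp => X Y l e f; rewrite gform0l sgn0 scale1r hcomp1r.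
Qed.
Next Obligation.
by rewrite /op_comp => X Y l e f; rewrite gform0r sgn0 scale1r hcomp1l.
Qed.
Next Obligation. by move=> *; exact: hdiffK. Qed.
Next Obligation.
rewrite /op_comp => X Y Z l m n l' m' n' e en el e1 em e2 g f.
rewrite hdiffZ (hdiff_comp _ _ em (etrans (addrC _ _) e2) el
  (etrans (addrC _ _) e1)) scalerDr !scalerA -!sgnD [LHS]addrC.
congr (sgn _ _ *: _ + sgn _ _ *: _).
- by rewrite -el gform_addl.
- by rewrite -em gform_addr (gform_sym l giota) addrCA addZ2 addr0.
Qed.

End Opposite.

Section Shift.
Variables (G : dgGround) (C : dgCat G).

(* [(i, X)] is q^i X. *)
Definition shift_obj := (gG G * C)%type.

Definition shift_hom (P Q : shift_obj) l := Hom C P.2 Q.2 (l + P.1 - Q.1).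

Lemma shift_id_deg (i : gG G) : 0 = 0 + i - i.
Proof. by rewrite add0r subrr. Qed.

Lemma shift_comp_deg (i j k l m n : gG G) :
  l + m = n -> (l + j - k) + (m + i - j) = n + i - k.
Proof.
move=> <-; rewrite [l + j - k]addrAC -(addrA (l - k)) (addrC j) subrK.
by rewrite -(addrA l m) [RHS]addrAC.
Qed.

Lemma shift_diff_deg (i j l l' : gG G) :
  l + giota = l' -> (l + i - j) + giota = l' + i - j.
Proof. by move=> <-; rewrite addrAC (addrAC l). Qed.

Definition shift_id (P : shift_obj) : shift_hom P P 0 :=
  hcast (shift_id_deg P.1) (hid P.2).

Definition shift_comp P Q R l m n (e : l + m = n)
    (g : shift_hom Q R l) (f : shift_hom P Q m) : shift_hom P R n :=
  hcomp (shift_comp_deg P.1 Q.1 R.1 e) g f.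

Definition shift_diff P Q l l' (e : l + giota = l') (f : shift_hom P Q l) :
    shift_hom P Q l' :=
  ksgn G giota Q.1 *: hdiff (shift_diff_deg P.1 Q.1 e) f.

Lemma hcast_id_compl X Y l m n (e0 : 0 = l) (e : l + m = n) (e' : m = n)
    (f : Hom C X Y m) : hcomp e (hcast e0 (hid Y)) f = hcast e' f.
Proof. by case: _ / e0 e => e; case: _ / e' e => e /=; rewrite hcomp1l. Qed.

Lemma hcast_id_compr X Y l m n (e0 : 0 = l) (e : m + l = n) (e' : m = n)
    (f : Hom C X Y m) : hcomp e f (hcast e0 (hid X)) = hcast e' f.
Proof. by case: _ / e0 e => e; case: _ / e' e => e /=; rewrite hcomp1r. Qed.

Program Definition dgShift : dgCat G :=
  @DgCat G shift_obj shift_hom shift_id shift_comp shift_diff _ _ _ _ _ _ _ _.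
Next Obligation.
by move=> P Q R l m n e f a u v; rewrite /shift_comp hcomp_linl.
Qed.
Next Obligation.
by move=> P Q R l m n e f a u v; rewrite /shift_comp hcomp_linr.
Qed.
Next Obligation.
move=> P Q l l' e a u v.
by rewrite /shift_diff hdiff_lin scalerDr !scalerA mulrC.
Qed.
Next Obligation. by move=> *; apply: hcompA. Qed.
Next Obligation.
by move=> *; rewrite /shift_comp (hcast_id_compl _ _ erefl).
Qed.
Next Obligation.
by move=> *; rewrite /shift_comp (hcast_id_compr _ _ erefl).
Qed.
Next Obligation. by move=> *; rewrite /shift_diff hdiffZ hdiffK !scaler0. Qed.
Next Obligation.
move=> [i X] [j Y] [k Z] l m n l' m' n' e en el e1 em e2 g f.
rewrite /shift_diff /shift_comp /=.
rewrite (hdiff_comp _ _ (shift_diff_deg j k el) (shift_comp_deg i j k e1)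
  (shift_diff_deg i j em) (shift_comp_deg i j k e2)).
rewrite hcompZl hcompZr scalerDr !scalerA -!sgnD; congr (_ + sgn _ _ *: _).
by rewrite 2!gform_addr gformNr addrC -addrA addZ2 addr0.
Qed.

End Shift.

(* Product of a finite family of modules; the library only treats the
   non-dependent case. *)
Section FinProd.
Variables (R : pzRingType) (I : finType) (M : I -> lmodType R).

Definition finprod := {dffun forall i, M i}.
HB.instance Definition _ := Choice.on finprod.
Implicit Types f g h : finprod.

Definition finprod_zero : finprod := [ffun i => 0 : M i].
Definition finprod_opp f : finprod := [ffun i => - f i].
Definition finprod_add f g : finprod := [ffun i => f i + g i].
Definition finprod_scale k f : finprod := [ffun i => k *: f i].

Fact finprod_addA : associative finprod_add.
Proof. by move=> f g h; apply/ffunP=> i; rewrite !ffunE addrA. Qed.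
Fact finprod_addC : commutative finprod_add.
Proof. by move=> f g; apply/ffunP=> i; rewrite !ffunE addrC. Qed.
Fact finprod_add0 : left_id finprod_zero finprod_add.
Proof. by move=> f; apply/ffunP=> i; rewrite !ffunE add0r. Qed.
Fact finprod_addN : left_inverse finprod_zero finprod_opp finprod_add.
Proof. by move=> f; apply/ffunP=> i; rewrite !ffunE addNr. Qed.
HB.instance Definition _ := GRing.isZmodule.Build finprod
  finprod_addA finprod_addC finprod_add0 finprod_addN.

Fact finprod_scaleA k l f :
  finprod_scale k (finprod_scale l f) = finprod_scale (k * l) f.
Proof. by apply/ffunP=> i; rewrite !ffunE scalerA. Qed.
Fact finprod_scale1 : left_id 1 finprod_scale.
Proof. by move=> f; apply/ffunP=> i; rewrite !ffunE scale1r. Qed.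
Fact finprod_scaleDr : right_distributive finprod_scale +%R.
Proof. by move=> k f g; apply/ffunP=> i; rewrite !ffunE scalerDr. Qed.
Fact finprod_scaleDl f : {morph finprod_scale^~ f : k l / k + l}.
Proof. by move=> k l; apply/ffunP=> i; rewrite !ffunE scalerDl. Qed.
HB.instance Definition _ := GRing.Zmodule_isLmodule.Build R finprod
  finprod_scaleA finprod_scale1 finprod_scaleDr finprod_scaleDl.

Lemma finprod0E i : (0 : finprod) i = 0.
Proof. exact: ffunE. Qed.
Lemma finprodDE f g i : (f + g) i = f i + g i.
Proof. exact: ffunE. Qed.
Lemma finprodZE k f i : (k *: f) i = k *: f i.
Proof. exact: ffunE. Qed.

End FinProd.

Section Additive.
Variables (G : dgGround) (C : dgCat G).

Record add_obj := AddObj { add_index : finType; add_term : add_index -> C }.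
Implicit Types P Q R : add_obj.

Definition add_hom P Q l : lmodType (gK G) :=
  finprod (fun ab : add_index Q * add_index P =>
    Hom C (add_term ab.2) (add_term ab.1) l).

Definition add_entry P Q l (f : add_hom P Q l) (a : add_index Q)
    (b : add_index P) : Hom C (add_term b) (add_term a) l := f (a, b).

Definition add_id_entry P (a b : add_index P) :
    Hom C (add_term b) (add_term a) 0 :=
  if a =P b is ReflectT e
  then ecast c (Hom C (add_term c) (add_term a) 0) e (hid (add_term a))
  else 0.

Definition add_id P : add_hom P P 0 := [ffun ab => add_id_entry ab.1 ab.2].

Definition add_comp P Q R l m n (e : l + m = n) (g : add_hom Q R l)
    (f : add_hom P Q m) : add_hom P R n :=
  [ffun ac => \sum_b hcomp e (add_entry g ac.1 b) (add_entry f b ac.2)].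

Definition add_diff P Q l l' (e : l + giota = l') (f : add_hom P Q l) :
    add_hom P Q l' :=
  [ffun ab => hdiff e (add_entry f ab.1 ab.2)].

Lemma add_id_entry_diag P (a : add_index P) :
  add_id_entry a a = hid (add_term a).
Proof.
by rewrite /add_id_entry; case: eqP => // e; rewrite (eq_irrelevance e erefl).
Qed.

Lemma add_id_entry_off P (a b : add_index P) : a != b -> add_id_entry a b = 0.
Proof. by rewrite /add_id_entry; case: eqP. Qed.

Program Definition dgAdd : dgCat G :=
  @DgCat G add_obj add_hom add_id add_comp add_diff _ _ _ _ _ _ _ _.
Next Obligation.
move=> P Q R l m n e f a u v; apply/ffunP => -[x z].
rewrite finprodDE finprodZE !ffunE /add_entry /= scaler_sumr -big_split.
by apply: eq_bigr => y _; rewrite finprodDE finprodZE hcomp_linl.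
Qed.
Next Obligation.
move=> P Q R l m n e f a u v; apply/ffunP => -[x z].
rewrite finprodDE finprodZE !ffunE /add_entry /= scaler_sumr -big_split.
by apply: eq_bigr => y _; rewrite finprodDE finprodZE hcomp_linr.
Qed.
Next Obligation.
move=> P Q l l' e a u v; apply/ffunP => -[x y].
by rewrite finprodDE finprodZE !ffunE /add_entry /= finprodDE finprodZE hdiff_lin.
Qed.
Next Obligation.
move=> P Q R S l m n lm mn k e1 e2 e3 e4 h g f; apply/ffunP => -[x w].
rewrite !ffunE /add_entry /=.
under eq_bigr => y _ do rewrite ffunE /add_entry /= hcomp_suml.
rewrite exchange_big /=; apply: eq_bigr => y _.
by rewrite ffunE /add_entry /= hcomp_sumr; apply: eq_bigr => z _; apply: hcompA.
Qed.
Next Obligation.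
move=> P Q l e f; apply/ffunP => -[x y]; rewrite ffunE /add_entry /= (bigD1 x) //=.
rewrite ffunE /add_entry /= add_id_entry_diag hcomp1l big1 ?addr0 // => z zx.
by rewrite ffunE /add_entry /= add_id_entry_off 1?eq_sym // hcomp0l.
Qed.
Next Obligation.
move=> P Q l e f; apply/ffunP => -[x y]; rewrite ffunE /add_entry /= (bigD1 y) //=.
rewrite ffunE /add_entry /= add_id_entry_diag hcomp1r big1 ?addr0 // => z zx.
by rewrite ffunE /add_entry /= add_id_entry_off // hcomp0r.
Qed.
Next Obligation.
move=> P Q l l' l'' e e' f; apply/ffunP => -[x y].
by rewrite finprod0E !ffunE /add_entry ffunE; apply: hdiffK.
Qed.
Next Obligation.
move=> P Q R l m n l' m' n' e en el e1 em e2 g f; apply/ffunP => -[x z].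
rewrite finprodDE finprodZE !ffunE /add_entry ffunE /= hdiff_sum scaler_sumr -big_split.
by apply: eq_bigr => y _; rewrite !ffunE /add_entry; apply: hdiff_comp.
Qed.

End Additive.

Section Twist.
Variables (G : dgGround) (C : dgCat G).

Record tw_obj := TwObj {
  tw_base : C;
  tw_diff : Hom C tw_base tw_base giota;
  tw_mc : hdiff erefl tw_diff + hcomp erefl tw_diff tw_diff = 0
}.
Implicit Types P Q R : tw_obj.

Definition tw_hom P Q l := Hom C (tw_base P) (tw_base Q) l.

Definition tw_hdiff P Q l l' (e : l + giota = l') (f : tw_hom P Q l) :
    tw_hom P Q l' :=
  hdiff e f + hcomp (etrans (addrC giota l) e) (tw_diff Q) f
    - ksgn G giota l *: hcomp e f (tw_diff P).

Program Definition dgTw : dgCat G :=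
  @DgCat G tw_obj tw_hom (fun P => hid (tw_base P))
    (fun P Q R l m n e (g : tw_hom Q R l) (f : tw_hom P Q m) => hcomp e g f)
    tw_hdiff _ _ _ _ _ _ _ _.
Next Obligation. by move=> P Q R l m n e f a u v; rewrite hcomp_linl. Qed.
Next Obligation. by move=> P Q R l m n e f a u v; rewrite hcomp_linr. Qed.
Next Obligation.
move=> P Q l l' e a u v; rewrite /tw_hdiff hdiff_lin hcomp_linl hcomp_linr.
rewrite !scalerDr scalerN !scalerA (mulrC a) opprD.
rewrite (addrACA (a *: hdiff e u)).
exact: addrACA.
Qed.
Next Obligation. by move=> *; apply: hcompA. Qed.
Next Obligation. by move=> *; apply: hcomp1l. Qed.
Next Obligation. by move=> *; apply: hcomp1r. Qed.
Next Obligation.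
move=> P Q l l' l'' e e' f; rewrite /tw_hdiff; case: _ / e e' => e'.
have e1 : (giota + giota) + l = l'' by rewrite addrAC [giota + l]addrC.
have e2 : l + (giota + giota) = l'' by rewrite addrA.
have mcN (R : tw_obj) :
  hdiff erefl (tw_diff R) = - hcomp erefl (tw_diff R) (tw_diff R).
  by apply/eqP; rewrite -addr_eq0 (tw_mc R).
rewrite !hdiffD hdiffN hdiffZ hdiffK add0r.
rewrite (hdiff_comp _ _ erefl e1 erefl (etrans (addrC _ _) e')).
rewrite (hdiff_comp _ _ erefl e' erefl e2) giota_odd sgn1 scaleN1r !mcN.
rewrite hcompNl hcompNr ksgnS scaleNr opprK !(hcompDl, hcompDr).
rewrite hcompNl hcompNr hcompZl hcompZr !scalerDr !scalerN !scalerA sgnK.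
rewrite !scale1r; move: (etrans _ erefl) (etrans _ e') => el er.
rewrite (hcompA erefl e1 el er) (hcompA el e' erefl er).
rewrite (hcompA erefl e' erefl e2) opprD opprK !addrA.
rewrite [LHS](ACl (1 * 6 * (2 * 5) * (3 * 8) * (4 * 10) * (7 * 9)))%AC /=.
by rewrite addNr !addNr !subrr !addr0.
Qed.
Next Obligation.
move=> P Q R l m n l' m' n' e en el e1 em e2 g f; rewrite /tw_hdiff.
have -> : ksgn G giota n = ksgn G giota l * ksgn G giota m.
  by rewrite -e gform_addr sgnD.
rewrite (hdiff_comp _ en el e1 em e2) -scalerA.
rewrite !(hcompDl, hcompDr, hcompNl, hcompNr) hcompZl hcompZr !scalerDr !scalerN.
rewrite (hcompA (etrans (addrC _ _) el) e1 e (etrans (addrC _ _) en)).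
rewrite (hcompA e en em e2) (hcompA el e1 (etrans (addrC _ _) em) e2) !addrA.
rewrite [RHS](ACl (1 * 4 * 2 * 6 * (3 * 5)))%AC /= addNr addr0.
by rewrite (addrAC (hcomp e1 _ f)).
Qed.

End Twist.

Section FullSubcategory.
Variables (G : dgGround) (C : dgCat G) (P : C -> Prop).

Program Definition dgFull : dgCat G :=
  @DgCat G {X : C | P X} (fun X Y l => Hom C (sval X) (sval Y) l)
    (fun X => hid (sval X)) (fun _ _ _ _ _ _ e g f => hcomp e g f)
    (fun _ _ _ _ e f => hdiff e f) _ _ _ _ _ _ _ _.
Next Obligation. by move=> *; apply: hcomp_linl. Qed.
Next Obligation. by move=> *; apply: hcomp_linr. Qed.
Next Obligation. by move=> *; apply: hdiff_lin. Qed.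
Next Obligation. by move=> *; apply: hcompA. Qed.
Next Obligation. by move=> *; apply: hcomp1l. Qed.
Next Obligation. by move=> *; apply: hcomp1r. Qed.
Next Obligation. by move=> *; apply: hdiffK. Qed.
Next Obligation. by move=> *; apply: hdiff_comp. Qed.

End FullSubcategory.

Definition dgTwix G (C : dgCat G) : dgCat G := dgTw (dgAdd (dgShift C)).

(* [r b a] reads b <= a. *)
Definition one_sided G (C : dgCat G) (X : dgTwix C) : Prop :=
  exists r : rel (add_index (tw_base X)),
    [/\ reflexive r, antisymmetric r, transitive r &
      forall a b, ~~ (r b a && (b != a)) -> add_entry (tw_diff X) a b = 0].

Definition dgPretr G (C : dgCat G) : dgCat G := dgFull (@one_sided G C).

Variant envelope := EnvS | EnvA | EnvTw | EnvTwix | EnvPretr.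

Definition env (E : envelope) G (C : dgCat G) : dgCat G :=
  match E with
  | EnvS => dgShift C
  | EnvA => dgAdd C
  | EnvTw => dgTw C
  | EnvTwix => dgTwix C
  | EnvPretr => dgPretr C
  end.

(* Main.v *)
Require Import Defs.
From mathcomp Require Import all_boot all_algebra ring.
From Stdlib Require Import FunctionalExtensionality ProofIrrelevance.
From Stdlib Require Import IndefiniteDescription.

(** For each envelope there is a dg functor from [E(C)^op] to [E(C^op)] that is
    bijective on objects and on all morphism modules, and such a functor has a
    strict inverse ([dgIso_of_bij]).  So the content is the choice of signs that
    makes the obvious bijections compatible with composition and differentials.

    - Shifts ([shift_op]).  The object [q^i X] must go to [q^(-i) X], since the
      degree shift of a morphism is the shift of its source minus that of its
      target and source and target are exchanged.  A morphism of degree [l] from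
      [q^i X] to [q^j Y] is multiplied by [(-1)^<l+i, i+j>].  This corrects the
      difference between the Koszul signs [<l, m>], computed from the degrees in
      [S(C)], and [<l+j+k, m+i+j>], computed from those in [C]
      ([shift_op_sign_comp]).
    - Sums ([add_op]).  Matrices are transposed.  The Koszul sign of a product
      depends on degrees only, hence is common to all terms of the matrix product.
    - Twists ([tw_op]).  The object [tw_alpha(X)] goes to [tw_(-alpha)(X)] and
      morphisms are unchanged.  As [<iota, iota> = 1], composing in the opposite
      category changes the sign of [alpha^2], so the Maurer-Cartan expression of
      [- alpha] in [C^op] is minus that of [alpha] in [C] ([tw_op_mcE]).

    The operations [A] and [Tw] act on dg functors ([add_map], [tw_map]) and
    preserve this kind of bijectivity, so [Twix] follows by composing
    [Tw(A(S(C)))^op -> Tw(A(S(C))^op) -> Tw(A(S(C)^op)) -> Tw(A(S(C^op)))].  On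
    twisting matrices the composite transposes up to signs; hence reversing the
    partial order on the index set matches the one-sided complexes on both sides
    ([twix_op_one_sided]), which gives the case of [Pretr]. *)

Set Implicit Arguments.
Unset Strict Implicit.
Unset Printing Implicit Defensive.

Import Defs GRing.Theory.
Local Open Scope ring_scope.

(** * Dg functors that are bijective on objects and on morphisms *)

Definition onto (A B : Type) (f : A -> B) := forall y, exists x, f x = y.

(** The choice is classical: the inverse of a functor has to be a function into
    objects and morphisms, but surjectivity only asserts existence. *)
Definition preim_of A B (f : A -> B) (fO : onto f) y : A :=
  sval (constructive_indefinite_description _ (fO y)).

Lemma preim_ofK A B (f : A -> B) (fO : onto f) : cancel (preim_of fO) f.
Proof. by move=> y; rewrite /preim_of; case: constructive_indefinite_description. Qed.

Record dgBij G (C D : dgCat G) (P : dgFunctor C D) : Prop := DgBij {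
  bij_obj_inj : injective (fobj P);
  bij_obj_onto : onto (fobj P);
  bij_hom_inj : forall X Y l, injective (@fhom _ _ _ P X Y l);
  bij_hom_onto : forall X Y l, onto (@fhom _ _ _ P X Y l)
}.

(** Packing a morphism with its ends lets the actions of two functors on morphisms
    be compared when their actions on objects agree only propositionally. *)
Definition homSig G (D : dgCat G) l (X Y : D) (f : Hom D X Y l) :
    {XY : (D * D)%type & Hom D XY.1 XY.2 l} :=
  existT (fun XY : (D * D)%type => Hom D XY.1 XY.2 l) (X, Y) f.

(** Function extensionality first identifies the object maps; the two families of
    maps on morphisms then have the same type, and the functor laws are
    propositions. *)
Lemma dgFunctor_eq G (C D : dgCat G) (P Q : dgFunctor C D) :
    fobj P =1 fobj Q ->
    (forall X Y l (f : Hom C X Y l), homSig (fhom P f) = homSig (fhom Q f)) ->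
  P = Q.
Proof.
case: P Q => [p hp p1 p2 p3 p4] [q hq q1 q2 q3 q4] /= /functional_extensionality e.
case: _ / e hq q1 q2 q3 q4 => hq q1 q2 q3 q4 eh.
have e : hp = hq.
  do 4![apply: functional_extensionality_dep => ?].
  exact: inj_pair2 (eh _ _ _ _).
case: _ / e q1 q2 q3 q4 {eh} => q1 q2 q3 q4.
by congr DgFunctor; apply: proof_irrelevance.
Qed.

Section Transport.
Variables (G : dgGround) (D : dgCat G).

Definition obcast (X X' Y Y' : D) l (eX : X = X') (eY : Y = Y')
    (f : Hom D X Y l) : Hom D X' Y' l :=
  ecast Z (Hom D Z Y' l) eX (ecast Z (Hom D X Z l) eY f).

Lemma homSig_obcast X X' Y Y' l (eX : X = X') (eY : Y = Y') (f : Hom D X Y l) :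
  homSig (obcast eX eY f) = homSig f.
Proof. by case: _ / eX; case: _ / eY. Qed.

Lemma homSig_inj X Y l : injective (@homSig G D l X Y).
Proof. by move=> f g; apply: inj_pair2. Qed.

End Transport.

(** The inverse functor has to move a morphism of [D] between preimages, which is
    possible only after transport along [P (g X) = X]; its laws hold because they
    do after applying [P], which is injective on morphisms. *)
Section Inverse.
Variables (G : dgGround) (C D : dgCat G) (P : dgFunctor C D) (bP : dgBij P).

Let g : D -> C := preim_of (bij_obj_onto bP).
Let gK : cancel g (fobj P) := preim_ofK _.

Let h (X Y : D) l (f : Hom D X Y l) : Hom C (g X) (g Y) l :=
  preim_of (@bij_hom_onto _ _ _ _ bP (g X) (g Y) l)
    (obcast (esym (gK X)) (esym (gK Y)) f).

Let hK X Y l (f : Hom D X Y l) :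
  fhom P (h f) = obcast (esym (gK X)) (esym (gK Y)) f.
Proof. exact: preim_ofK. Qed.

Definition dgInverse : dgFunctor D C.
Proof.
refine (@DgFunctor _ _ _ g h _ _ _ _).
- move=> X Y l a u v; apply: (bij_hom_inj bP); rewrite fhom_lin !hK.
  by case: _ / (esym (gK X)); case: _ / (esym (gK Y)).
- move=> X; apply: (bij_hom_inj bP); rewrite hK fhom_id.
  by case: _ / (esym (gK X)).
- move=> X Y Z l m n e u v; apply: (bij_hom_inj bP); rewrite fhom_comp !hK.
  by case: _ / (esym (gK X)); case: _ / (esym (gK Y)); case: _ / (esym (gK Z)).
- move=> X Y l l' e f; apply: (bij_hom_inj bP); rewrite fhom_diff !hK.
  by case: _ / (esym (gK X)); case: _ / (esym (gK Y)).
Defined.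

Lemma dgIso_of_bij : dgIso C D.
Proof.
exists P, dgInverse; split; apply: dgFunctor_eq => /=.
- by move=> X; apply: (bij_obj_inj bP); rewrite gK.
- move=> X Y l f.
  (* Any proof of [Z = g (P Z)] may serve here: [homSig] forgets the transport,
     and eliminating the proof removes the transport on both sides. *)
  have gPK Z : Z = g (fobj P Z) by apply: (bij_obj_inj bP); rewrite gK.
  rewrite -(homSig_obcast (gPK X) (gPK Y) f); congr homSig.
  apply: (bij_hom_inj bP); rewrite hK; apply: homSig_inj; rewrite homSig_obcast.
  by case: _ / (gPK X); case: _ / (gPK Y).
- exact: gK.
- by move=> X Y l f; rewrite hK homSig_obcast.
Qed.

End Inverse.

Lemma dgBij_comp G (C D E : dgCat G) (Q : dgFunctor D E) (P : dgFunctor C D) :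
  dgBij Q -> dgBij P -> dgBij (dgFunctor_comp Q P).
Proof.
move=> bQ bP; split=> [||X Y l|X Y l] /=.
- by move=> X X' /(bij_obj_inj bQ)/(bij_obj_inj bP).
- move=> Z; have [Y <-] := bij_obj_onto bQ Z.
  by have [X <-] := bij_obj_onto bP Y; exists X.
- by move=> f f' /(bij_hom_inj bQ)/(bij_hom_inj bP).
- move=> w; have [v <-] := bij_hom_onto bQ w.
  by have [u <-] := bij_hom_onto bP v; exists u.
Qed.

Section FunctorTheory.
Variables (G : dgGround) (C D : dgCat G) (P : dgFunctor C D).

Lemma fhomD X Y l (f g : Hom C X Y l) : fhom P (f + g) = fhom P f + fhom P g.
Proof. by have := fhom_lin P 1 f g; rewrite !scale1r. Qed.

Lemma fhom0 X Y l : fhom P (0 : Hom C X Y l) = 0.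
Proof. by apply: (@addrI _ (fhom P 0)); rewrite -fhomD !addr0. Qed.

Lemma fhomZ X Y l k (f : Hom C X Y l) : fhom P (k *: f) = k *: fhom P f.
Proof. by have := fhom_lin P k f 0; rewrite fhom0 !addr0. Qed.

Lemma fhomN X Y l (f : Hom C X Y l) : fhom P (- f) = - fhom P f.
Proof. by rewrite -scaleN1r fhomZ scaleN1r. Qed.

Lemma fhom_sum X Y l (I : finType) (f : I -> Hom C X Y l) :
  fhom P (\sum_i f i) = \sum_i fhom P (f i).
Proof.
by apply: (big_morph (fhom P)) => [u v|]; rewrite ?fhomD ?fhom0.
Qed.

End FunctorTheory.

(** * Shifts: the sign of the opposite *)

Section HcastTheory.
Variables (G : dgGround) (C : dgCat G).
Implicit Types X Y Z : C.

Lemma hcast_lin X Y l l' (e : l = l') :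
  linear (fun f : Hom C X Y l => hcast e f).
Proof. by case: _ / e. Qed.

Lemma hcastZ X Y l l' (e : l = l') k (f : Hom C X Y l) :
  hcast e (k *: f) = k *: hcast e f.
Proof. by case: _ / e. Qed.

Lemma hcast_irr X Y l l' (e e' : l = l') (f : Hom C X Y l) :
  hcast e f = hcast e' f.
Proof. by rewrite (eq_irrelevance e e'). Qed.

Lemma hcast_comp X Y Z l m n l' m' n' (el : l = l') (em : m = m') (en : n = n')
    (e : l + m = n) (e' : l' + m' = n') (g : Hom C Y Z l) (f : Hom C X Y m) :
  hcast en (hcomp e g f) = hcomp e' (hcast el g) (hcast em f).
Proof.
case: _ / el e'; case: _ / em; case: _ / en => e' /=.
by rewrite (eq_irrelevance e e').
Qed.

Lemma hcast_diff X Y l n l' n' (el : l = l') (en : n = n')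
    (e : l + giota = n) (e' : l' + giota = n') (f : Hom C X Y l) :
  hcast en (hdiff e f) = hdiff e' (hcast el f).
Proof. by case: _ / el e'; case: _ / en => e'; rewrite (eq_irrelevance e e'). Qed.

Lemma hcast_trans X Y l m n (e : l = m) (e' : m = n) (f : Hom C X Y l) :
  hcast e' (hcast e f) = hcast (etrans e e') f.
Proof. by case: _ / e'. Qed.

Lemma hcast_inj X Y l l' (e : l = l') :
  injective (fun f : Hom C X Y l => hcast e f).
Proof. by case: _ / e. Qed.

Lemma hcast_onto X Y l l' (e : l = l') : onto (fun f : Hom C X Y l => hcast e f).
Proof. by case: _ / e => f; exists f. Qed.

End HcastTheory.

Lemma sgn_scaleK (G : dgGround) a (V : lmodType (gK G)) (f : V) :
  sgn (gK G) a *: (sgn (gK G) a *: f) = f.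
Proof. by rewrite scalerA sgnK scale1r. Qed.

Section ShiftOp.
Variables (G : dgGround) (C : dgCat G).

(** The part [<l, i+j>] accounts for the terms of [shift_op_sign_comp] that
    involve the degrees of the morphisms; the remaining part [<i, i+j>] is a
    cochain in [(i, j)] alone, chosen so that its coboundary is [<i+j, j+k>] and
    that it vanishes for [i = j], as preservation of identities requires. *)
Definition shift_op_sign (i j l : gG G) : 'Z_2 := gform (l + i) (i + j).

Lemma shift_op_deg (i j l : gG G) : l + j - i = l + - i - - j.
Proof. by rewrite opprK addrAC. Qed.

Definition shift_op_hom (X Y : dgOp (dgShift C)) l
    (f : Hom (dgOp (dgShift C)) X Y l) : Hom C Y.2 X.2 (l + - X.1 - - Y.1) :=
  sgn (gK G) (shift_op_sign X.1 Y.1 l) *: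
    hcast (shift_op_deg X.1 Y.1 l) (f : Hom C Y.2 X.2 (l + Y.1 - X.1)).

(** Compatibility with composition: on the left the opposite of the shifted
    category, with Koszul sign from the degrees [l] and [m]; on the right the shift
    of the opposite, where the sign comes from the degrees in [C]. *)
Lemma shift_op_sign_comp i j k l m n : l + m = n ->
  shift_op_sign i k n + gform l m =
    gform (l - j - - k) (m - i - - j)
      + (shift_op_sign i j m + shift_op_sign j k l).
Proof.
move=> <-; rewrite /shift_op_sign !opprK !gform_addr !gform_addl.
rewrite !gformNr !(gform_sym (- j)) !gformNr.
rewrite (gform_sym k m) (gform_sym k i) (gform_sym k j).
(* The two sides differ by terms that occur twice, and the signs live in
   characteristic 2. *)
set twice := gform m j + gform i j + gform l j + gform j j + gform j k.
by rewrite -[LHS]addr0 -(addZ2 twice) /twice; ring.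
Qed.

(** Compatibility with differentials: the sign of the differential of a shifted
    morphism comes from the target, which is [q^i X] in the opposite category and
    [q^(-j) Y] after the shift. *)
Lemma shift_op_sign_diff i j l l' : l + giota = l' ->
  shift_op_sign i j l' + gform giota i =
    gform giota (- j) + shift_op_sign i j l.
Proof.
move=> <-; rewrite /shift_op_sign gformNr !gform_addl !gform_addr.
by rewrite -[RHS]addr0 -(addZ2 (gform giota i)); ring.
Qed.

Definition shift_op : dgFunctor (dgOp (dgShift C)) (dgShift (dgOp C)).
Proof.
refine (@DgFunctor G (dgOp (dgShift C)) (dgShift (dgOp C))
  (fun X => (- X.1, X.2)) shift_op_hom _ _ _ _).
- move=> X Y l a u v; rewrite /shift_op_hom /=.
  by rewrite hcast_lin scalerDr !scalerA mulrC.
- move=> [i X]; rewrite /shift_op_hom /shift_op_sign /= /shift_id /=.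
  rewrite gform_addr addZ2 sgn0 scale1r hcast_trans.
  exact: (@hcast_irr _ C).
- move=> [i X] [j Y] [k Z] l m n e g f.
  rewrite /= /shift_op_hom /= /shift_comp /= /op_comp /=.
  rewrite hcastZ hcompZl hcompZr !scalerA -!sgnD.
  rewrite (shift_op_sign_comp _ j _ e); congr (_ *: _).
  exact: hcast_comp.
- move=> [i X] [j Y] l l' e f.
  rewrite /= /shift_op_hom /= /shift_diff /=.
  rewrite hcastZ hdiffZ !scalerA -!sgnD.
  rewrite (shift_op_sign_diff _ _ e); congr (_ *: _).
  exact: hcast_diff.
Defined.

Lemma shift_op_bij : dgBij shift_op.
Proof.
split=> /=.
- by move=> [i X] [j Y] /= [/oppr_inj-> ->].
- by case=> i X; exists (- i, X); rewrite /= opprK.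
- move=> X Y l f f'; rewrite /= /shift_op_hom => eff'.
  apply: (hcast_inj (e := shift_op_deg X.1 Y.1 l)).
  by rewrite -[LHS](sgn_scaleK (shift_op_sign X.1 Y.1 l)) eff' sgn_scaleK.
- move=> X Y l f.
  have [u eu] := hcast_onto (shift_op_deg X.1 Y.1 l)
    (sgn (gK G) (shift_op_sign X.1 Y.1 l) *: (f : Hom C Y.2 X.2 _)).
  by exists u; rewrite /shift_op_hom eu sgn_scaleK.
Qed.

End ShiftOp.

(** * Finite direct sums *)

Lemma finprodNE (R : pzRingType) (I : finType) (M : I -> lmodType R)
    (f : finprod M) i : (- f) i = - f i.
Proof. exact: ffunE. Qed.

Section AddOp.
Variables (G : dgGround) (C : dgCat G).

Definition add_op_obj (X : dgOp (dgAdd C)) : dgAdd (dgOp C) :=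
  @AddObj G (dgOp C) (add_index X) (@add_term _ _ X).

Definition add_op_hom (X Y : dgOp (dgAdd C)) l
    (f : Hom (dgOp (dgAdd C)) X Y l) :
    add_hom (add_op_obj X) (add_op_obj Y) l :=
  [ffun ab => @add_entry G C Y X l f ab.2 ab.1].

Lemma add_op_homE (X Y : dgAdd C) l (f : Hom (dgAdd C) Y X l)
    (a : add_index Y) (b : add_index X) :
  @add_entry _ (dgOp C) (add_op_obj X) (add_op_obj Y) l (@add_op_hom X Y l f) a b =
    @add_entry _ C Y X l f b a.
Proof. by rewrite /add_entry ffunE. Qed.

Definition add_op : dgFunctor (dgOp (dgAdd C)) (dgAdd (dgOp C)).
Proof.
refine (@DgFunctor G (dgOp (dgAdd C)) (dgAdd (dgOp C))
  add_op_obj add_op_hom _ _ _ _).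
- move=> X Y l a u v; apply/ffunP => -[x y].
  by rewrite finprodDE finprodZE !ffunE /add_entry /= finprodDE finprodZE.
- move=> X; apply/ffunP => -[x y]; rewrite /add_op_hom !ffunE /add_entry /= !ffunE /=.
  have [->|xy] := eqVneq x y; first by rewrite !add_id_entry_diag.
  by rewrite !add_id_entry_off // eq_sym.
- move=> X Y Z l m n e g f; apply/ffunP => -[x z].
  rewrite /add_op_hom /= !ffunE /add_entry /= finprodZE !ffunE /= scaler_sumr.
  by apply: eq_bigr => y _; rewrite !ffunE.
- move=> X Y l l' e f; apply/ffunP => -[x y].
  by rewrite /add_op_hom /= /add_diff !ffunE /add_entry /= !ffunE.
Defined.

Lemma add_op_bij : dgBij add_op.
Proof.
pose back (Y : dgAdd (dgOp C)) : dgOp (dgAdd C) :=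
  @AddObj G C (add_index Y) (@add_term _ _ Y).
split=> /=.
- by apply: (can_inj (g := back)) => -[].
- by move=> Y; exists (back Y); case: Y.
- move=> X Y l f f' /ffunP eff'; apply/ffunP => -[x y].
  by have := eff' (y, x); rewrite !ffunE.
- move=> X Y l f.
  exists ([ffun ab => f (ab.2, ab.1)] : @add_hom G C Y X l).
  by apply/ffunP => -[x y]; rewrite !ffunE /add_entry ffunE.
Qed.

End AddOp.

Section AddMap.
Variables (G : dgGround) (C D : dgCat G) (P : dgFunctor C D).

Definition add_map_obj (X : dgAdd C) : dgAdd D :=
  AddObj (fun a : add_index X => fobj P (add_term a)).

Definition add_map_hom (X Y : dgAdd C) l (f : Hom (dgAdd C) X Y l) :
    add_hom (add_map_obj X) (add_map_obj Y) l :=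
  [ffun ab => fhom P (add_entry f ab.1 ab.2)].

Lemma add_map_homE (X Y : dgAdd C) l (f : Hom (dgAdd C) X Y l)
    (a : add_index Y) (b : add_index X) :
  @add_entry _ D (add_map_obj X) (add_map_obj Y) l (add_map_hom f) a b =
    fhom P (add_entry f a b).
Proof. by rewrite /add_entry ffunE. Qed.

Definition add_map : dgFunctor (dgAdd C) (dgAdd D).
Proof.
refine (@DgFunctor G (dgAdd C) (dgAdd D) add_map_obj add_map_hom _ _ _ _).
- move=> X Y l a u v; apply/ffunP => -[x y].
  rewrite finprodDE finprodZE !ffunE /add_entry /= finprodDE finprodZE.
  by rewrite fhom_lin.
- move=> X; apply/ffunP => -[x y]; rewrite !ffunE /add_entry !ffunE /=.
  have [->|xy] := eqVneq x y; first by rewrite !add_id_entry_diag fhom_id.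
  by rewrite !add_id_entry_off // fhom0.
- move=> X Y Z l m n e g f; apply/ffunP => -[x z].
  rewrite !ffunE /add_entry !ffunE /= fhom_sum.
  by apply: eq_bigr => y _; rewrite fhom_comp /add_entry !ffunE.
- move=> X Y l l' e f; apply/ffunP => -[x y].
  by rewrite !ffunE /add_entry !ffunE fhom_diff.
Defined.

Lemma add_map_bij : dgBij P -> dgBij add_map.
Proof.
move=> bP; pose g := preim_of (bij_obj_onto bP).
have gK : cancel g (fobj P) := preim_ofK _.
have Kg : cancel (fobj P) g by move=> X; apply: (bij_obj_inj bP); rewrite gK.
pose back (Y : dgAdd D) : dgAdd C := AddObj (fun a : add_index Y => g (add_term a)).
split.
- apply: (can_inj (g := back)) => -[I X]; rewrite /back /= /add_map_obj /=.
  by congr AddObj; apply: functional_extensionality => a; apply: Kg.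
- move=> [I X]; exists (back (AddObj X)); rewrite /= /add_map_obj /=.
  by congr AddObj; apply: functional_extensionality => a; apply: gK.
- move=> X Y l f f' /ffunP eff'; apply/ffunP => -[x y].
  by apply: (bij_hom_inj bP); have := eff' (x, y); rewrite !ffunE.
- move=> X Y l f.
  exists ([ffun ab => preim_of (@bij_hom_onto _ _ _ _ bP _ _ l) (f ab)] : @add_hom G C X Y l).
  by apply/ffunP => -[x y]; rewrite ffunE /add_entry ffunE preim_ofK.
Qed.

End AddMap.

(** * Twists *)

Lemma tw_obj_eq G (C : dgCat G) (X : C) (a b : Hom C X X giota) ma mb :
  a = b -> @TwObj G C X a ma = @TwObj G C X b mb.
Proof. by move=> e; case: _ / e mb => mb; congr TwObj; apply: proof_irrelevance. Qed.

Lemma hcomp_irr G (C : dgCat G) (X Y Z : C) l m n (e e' : l + m = n)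
    (g : Hom C Y Z l) (f : Hom C X Y m) : hcomp e g f = hcomp e' g f.
Proof. by rewrite (eq_irrelevance e e'). Qed.

Section TwOp.
Variables (G : dgGround) (C : dgCat G).

(** The differential is linear and the square quadratic in [a], but the square
    in the opposite category carries the sign [-1], as [<iota, iota> = 1]. *)
Lemma tw_op_mcE (X : C) (a : Hom C X X giota) :
  @hdiff _ (dgOp C) _ _ _ _ erefl (- a)
    + @hcomp _ (dgOp C) _ _ _ _ _ _ erefl (- a) (- a) =
  - (hdiff erefl a + hcomp erefl a a).
Proof.
rewrite /= /op_comp giota_odd sgn1 scaleN1r hdiffN hcompNl hcompNr opprK.
by rewrite -opprD (eq_irrelevance (etrans _ _) erefl).
Qed.

Lemma tw_op_mc (X : tw_obj C) :
  @hdiff _ (dgOp C) _ _ _ _ erefl (- tw_diff X)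
    + @hcomp _ (dgOp C) _ _ _ _ _ _ erefl (- tw_diff X) (- tw_diff X) = 0.
Proof. by rewrite tw_op_mcE tw_mc oppr0. Qed.

Definition tw_op_obj (X : dgOp (dgTw C)) : dgTw (dgOp C) :=
  TwObj (tw_op_mc X).

(** The two twisting terms of the differential exchange their roles.  They differ
    by the sign [- (-1)^<iota, l>]: the factor [(-1)^<iota, l>] is the Koszul sign of
    composing with a degree [iota] endomorphism in the opposite category, and
    passing from [alpha] to [- alpha] supplies the other [-1]. *)
Definition tw_op : dgFunctor (dgOp (dgTw C)) (dgTw (dgOp C)).
Proof.
refine (@DgFunctor G (dgOp (dgTw C)) (dgTw (dgOp C)) tw_op_obj
  (fun X Y l f => f) _ _ _ _).
- by [].
- by [].
- by [].
- move=> X Y l l' e f.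
  rewrite /= /tw_hdiff /= /op_comp hcompNl hcompNr !scalerN opprK.
  rewrite (gform_sym l) sgn_scaleK -!addrA [X in _ + X]addrC.
  congr (_ + (- (_ *: _) + _)); exact: hcomp_irr.
Defined.

Lemma tw_op_bij : dgBij tw_op.
Proof.
split=> /=.
- move=> [X a ma] [Y b mb] /= e.
  have eXY : X = Y by case: e.
  case: _ / eXY b mb e => b mb e; apply: tw_obj_eq.
  apply: oppr_inj; case: e; exact: inj_pair2.
- move=> [Y b mb].
  have ma : @hdiff _ C _ _ _ _ erefl (- b) + @hcomp _ C _ _ _ _ _ _ erefl (- b) (- b) = 0.
    by apply: oppr_inj; rewrite -tw_op_mcE opprK oppr0.
  exists (TwObj ma); apply: tw_obj_eq; exact: opprK.
- by move=> X Y l f f'.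
- by move=> X Y l f; exists f.
Qed.

End TwOp.

Section TwMap.
Variables (G : dgGround) (C D : dgCat G) (P : dgFunctor C D).

Lemma tw_map_mc (X : tw_obj C) :
  hdiff erefl (fhom P (tw_diff X))
    + hcomp erefl (fhom P (tw_diff X)) (fhom P (tw_diff X)) = 0.
Proof. by rewrite -fhom_diff -fhom_comp -fhomD tw_mc fhom0. Qed.

Definition tw_map : dgFunctor (dgTw C) (dgTw D).
Proof.
refine (@DgFunctor G (dgTw C) (dgTw D) (fun X => TwObj (tw_map_mc X))
  (fun X Y l f => fhom P f) _ _ _ _).
- by move=> X Y l a u v; apply: (fhom_lin P).
- by move=> X; apply: fhom_id.
- by move=> X Y Z l m n e g f; apply: fhom_comp.
- move=> X Y l l' e f.
  by rewrite /= /tw_hdiff /= !fhomD fhomN fhomZ fhom_diff !fhom_comp.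
Defined.

(** Surjectivity on objects needs full faithfulness twice: to lift the twist, and
    to see that the lift satisfies the Maurer-Cartan equation. *)
Lemma tw_map_bij : dgBij P -> dgBij tw_map.
Proof.
move=> bP; split.
- move=> [X a ma] [Y b mb] /= e.
  have eXY : X = Y by apply: (bij_obj_inj bP); case: e.
  case: _ / eXY b mb e => b mb e; apply: tw_obj_eq.
  apply: (bij_hom_inj bP); case: e; exact: inj_pair2.
- move=> [Y b mb]; have [X eX] := bij_obj_onto bP Y.
  case: _ / eX b mb => b mb; have [a ea] := bij_hom_onto bP b.
  case: _ / ea mb => mb.
  have ma : hdiff erefl a + hcomp erefl a a = 0.
    apply: (bij_hom_inj bP).
    by rewrite fhomD fhom_diff fhom_comp fhom0.
  by exists (TwObj ma); apply: tw_obj_eq.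
- by move=> X Y l; apply: (bij_hom_inj bP).
- by move=> X Y l; apply: (bij_hom_onto bP).
Qed.

End TwMap.

(** * Full subcategories and one-sided twisted complexes *)

Section FullMap.
Variables (G : dgGround) (C D : dgCat G) (p : C -> Prop) (q : D -> Prop).
Variable P : dgFunctor (dgOp C) D.
Hypothesis pq : forall X, p X <-> q (fobj P X).

Definition full_op : dgFunctor (dgOp (dgFull p)) (dgFull q).
Proof.
refine (@DgFunctor G (dgOp (dgFull p)) (dgFull q)
  (fun X => exist q (fobj P (sval X)) (proj1 (pq _) (svalP X)))
  (fun X Y l f => @fhom _ _ _ P (sval X) (sval Y) l f) _ _ _ _).
- by move=> X Y l; apply: (@fhom_lin _ _ _ P (sval X) (sval Y)).
- by move=> X; apply: (@fhom_id _ _ _ P (sval X)).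
- by move=> X Y Z l m n e g f; apply: (@fhom_comp _ _ _ P (sval X) (sval Y) (sval Z)).
- by move=> X Y l l' e f; apply: (@fhom_diff _ _ _ P (sval X) (sval Y)).
Defined.

Lemma full_op_bij : dgBij P -> dgBij full_op.
Proof.
move=> bP; split.
- move=> [X pX] [Y pY] /= [/(bij_obj_inj bP) e].
  by case: _ / e pY => pY; congr exist; apply: proof_irrelevance.
- move=> [Y qY]; have [X eX] := bij_obj_onto bP Y.
  case: _ / eX qY => qY; exists (exist p X (proj2 (pq X) qY)) => /=.
  by congr exist; apply: proof_irrelevance.
- by move=> X Y l; apply: (@bij_hom_inj _ _ _ _ bP (sval X) (sval Y)).
- by move=> X Y l; apply: (@bij_hom_onto _ _ _ _ bP (sval X) (sval Y)).
Qed.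

End FullMap.

Section Twix.
Variables (G : dgGround) (C : dgCat G).

Definition twix_op : dgFunctor (dgOp (dgTwix C)) (dgTwix (dgOp C)) :=
  dgFunctor_comp (tw_map (dgFunctor_comp (add_map (shift_op C)) (add_op (dgShift C))))
    (tw_op (dgAdd (dgShift C))).

Lemma twix_op_bij : dgBij twix_op.
Proof.
apply: dgBij_comp (tw_op_bij _); apply: tw_map_bij.
by apply: dgBij_comp (add_op_bij _); apply/add_map_bij/shift_op_bij.
Qed.

(** The composite acts on the twist by transposition, the change of sign of
    [tw_op] and the entrywise action of [shift_op]. *)
Lemma twix_op_entry (X : dgTwix C) (a b : add_index (tw_base X)) :
  @add_entry _ _ _ _ _ (tw_diff (fobj twix_op X)) a b =
    @fhom _ _ _ (shift_op C) (add_term b) (add_term a) _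
      (- add_entry (tw_diff X) b a).
Proof.
rewrite /= (@add_map_homE _ _ _ (shift_op C)) (@add_op_homE _ (dgShift C)).
by congr shift_op_hom; exact: (finprodNE (tw_diff X) (b, a)).
Qed.

Lemma twix_op_entry_eq0 (X : dgTwix C) (a b : add_index (tw_base X)) :
  @add_entry _ _ _ _ _ (tw_diff (fobj twix_op X)) a b = 0 <->
  add_entry (tw_diff X) b a = 0.
Proof.
rewrite twix_op_entry; split=> [e|->]; last by rewrite oppr0 (fhom0 (shift_op C)).
apply: oppr_inj; rewrite oppr0.
by apply: (bij_hom_inj (shift_op_bij C)); rewrite e (fhom0 (shift_op C)).
Qed.

(** The entries that vanish are transposed, so the opposite order works on the
    other side; this is symmetric, whence the equivalence. *)
Lemma twix_op_one_sided (X : dgTwix C) :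
  one_sided X <-> one_sided (fobj twix_op X : dgTwix (dgOp C)).
Proof.
split=> -[r [r0 ra rt rX]]; exists (fun x y => r y x).
all: split=> [x|x y /andP[xy yx]|x y z yx xz|a b nab] //.
1, 4: by apply: ra; rewrite xy yx.
1, 3: exact: rt xz yx.
- by apply/twix_op_entry_eq0; apply: rX; rewrite eq_sym.
- by apply/twix_op_entry_eq0; apply: rX; rewrite eq_sym.
Qed.

End Twix.

Theorem proposition4p3 (G : dgGround) (E : envelope) (C : dgCat G) :
  dgIso (dgOp (env E C)) (env E (dgOp C)).
Proof.
case: E => /=.
- exact: dgIso_of_bij (shift_op_bij C).
- exact: dgIso_of_bij (add_op_bij C).
- exact: dgIso_of_bij (tw_op_bij C).
- exact: dgIso_of_bij (twix_op_bij C).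
- exact: dgIso_of_bij (full_op_bij (@twix_op_one_sided _ C) (twix_op_bij C)).
Qed.
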